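(* Let $X$ be a finite-dimensional integral normal Noetherian $F$-finite $\mathbb{F}_p$-scheme such that for every $m\in\mathbb{Z}_{>0}$ the scheme $W_mX$ is excellent and admits a dualising complex. Take integers $e\geq 2$ and $n\geq 1$. Then the following are equivalent. 1. $X$ is $F$-split, i.e. $F:\mathcal{O}_X\to F_*\mathcal{O}_X$ splits as an $\mathcal{O}_X$-module homomorphism. 2. $\Phi^e_{X,n}:\mathcal{O}_X\to Q^e_{X,n}$ splits as a $W_n\mathcal{O}_X$-module homomorphism.
   Context: $F$ is the absolute Frobenius; $F$-finite means $F$ is finite. $W_nX:=(X,W_n\mathcal{O}_X)$ is given by Witt vectors of length $n$. $\mathcal{O}_X$ is a $W_n\mathcal{O}_X$-module via the projection $R^{n-1}:W_n\mathcal{O}_X\to\mathcal{O}_X$ onto the first component. The $W_n\mathcal{O}_X$-module $Q^e_{X,n}$ and the homomorphism $\Phi^e_{X,n}:\mathcal{O}_X\to Q^e_{X,n}$ are defined by the pushout, in $W_n\mathcal{O}_X$-modules, of $F^e:W_n\mathcal{O}_X\to F^e_*W_n\mathcal{O}_X$ and $R^{n-1}:W_n\mathcal{O}_X\to\mathcal{O}_X$. *)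

(* Defs.v *)
From HB Require Import structures.
From mathcomp Require Import all_boot all_order all_algebra all_field.
From mathcomp Require mpoly.
From mathcomp Require Import boolp.
Set Implicit Arguments.
Unset Strict Implicit.
Unset Printing Implicit Defensive.
Import GRing.Theory Num.Theory.
Local Open Scope ring_scope.

Module Witt.
Import mpoly.

Section Ghost.
Variables (p : nat) (n : nat).

Definition ghost (R : comPzRingType) (x : n.-tuple R) (k : nat) : R :=
  \sum_(i < k.+1) x`_i ^+ (p ^ (k - i)) *+ (p ^ i).

Lemma nth_map0 (R S : comPzRingType) (f : {rmorphism R -> S}) (x : n.-tuple R) i :
  [tuple of map f x]`_i = f x`_i.
Proof.
have [h|h] := ltnP i (size x); first exact: nth_map.
by rewrite !nth_default ?rmorph0 // size_map.
Qed.

Lemma ghost_map (R S : comPzRingType) (f : {rmorphism R -> S}) (x : n.-tuple R) k :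
  ghost [tuple of map f x] k = f (ghost x k).
Proof.
rewrite /ghost rmorph_sum /=; apply: eq_bigr => i _.
by rewrite nth_map0 rmorphMn rmorphXn.
Qed.

End Ghost.

(* Values of an integer polynomial in a ring that may be trivial. *)
Section Eval.
Variables (N : nat) (R : comPzRingType) (v : 'I_N -> R).

Definition peval (f : {mpoly int[N]}) : R :=
  \sum_(m <- msupp f) (f@_m)%:~R * \prod_(i < N) v i ^+ m i.

Lemma trivial_ring : (1 : R) = 0 -> forall x y : R, x = y.
Proof. by move=> h x y; rewrite -[x]mulr1 -[y]mulr1 h !mulr0. Qed.

Lemma peval_spec : [/\ zmod_morphism peval, monoid_morphism peval &
  forall i, peval 'X_i = v i].
Proof.
have [h|h] := pselect ((1 : R) = 0).
  have t := trivial_ring h.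
  by split; [move=> x y; exact: t|split; [exact: t|move=> x y; exact: t]|move=> i; exact: t].
pose nz := GRing.PzSemiRing_isNonZero.Build R (introN eqP h).
pose R' : comNzRingType := HB.pack_for comNzRingType (GRing.ComPzRing.sort R) nz.
pose v' : 'I_N -> R' := v.
have E f : peval f = mmap (intr : int -> R') v' f by [].
split.
- by move=> x y; rewrite !E mmapB.
- split; first by rewrite E rmorph1.
  by move=> x y; rewrite !E rmorphM.
- by move=> i; rewrite E mmapX mmap1U.
Qed.

HB.instance Definition _ := GRing.isZmodMorphism.Build _ _ peval
  (let: And3 a _ _ := peval_spec in a).
HB.instance Definition _ := GRing.isMonoidMorphism.Build _ _ peval
  (let: And3 _ a _ := peval_spec in a).

Lemma pevalX i : peval 'X_i = v i.
Proof. by case: peval_spec. Qed.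

End Eval.

Lemma rmorph_mpoly_eq N (R : comPzRingType) (f g : {rmorphism {mpoly int[N]} -> R}) :
  (forall i, f 'X_i = g 'X_i) -> f =1 g.
Proof.
move=> fg q; rewrite (mpolyE q) !rmorph_sum; apply: eq_bigr => m _ /=.
rewrite -mul_mpolyC !rmorphM /=; congr (_ * _).
  have -> : (q@_m)%:MP_[N] = (q@_m)%:~R :> {mpoly int[N]}.
    by rewrite -[in LHS](intz q@_m) rmorph_int.
  by rewrite !rmorph_int.
rewrite mpolyXE_id !rmorph_prod; apply: eq_bigr => i _.
by rewrite !rmorphXn fg.
Qed.

Lemma mpoly_torsion N (a : {mpoly int[N]}) k : (0 < k)%N -> a *+ k = 0 -> a = 0.
Proof.
move=> k0 /mpolyP h; apply/mpolyP => m; move: (h m).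
rewrite mcoeffMn mcoeff0 => /eqP; rewrite mulrn_eq0 => /orP[/eqP k00|/eqP //].
by rewrite k00 in k0.
Qed.

Section Congruence.
Variables (p : nat) (pp : prime p) (A : comPzRingType).
Local Notation p0 := (prime_gt0 pp).

Definition pdvd (k : nat) (a b : A) := exists c, a = b + c *+ (p ^ k).

Lemma pdvdD k a b a' b' : pdvd k a b -> pdvd k a' b' -> pdvd k (a + a') (b + b').
Proof. by move=> [c ->] [c' ->]; exists (c + c'); rewrite mulrnDl addrACA. Qed.
Lemma pdvdN k a b : pdvd k a b -> pdvd k (- a) (- b).
Proof. by move=> [c ->]; exists (- c); rewrite mulNrn opprD. Qed.
Lemma pdvdM k a b a' b' : pdvd k a b -> pdvd k a' b' -> pdvd k (a * a') (b * b').
Proof.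
move=> [c ->] [c' ->]; exists (c * b' + b * c' + c * c' *+ (p ^ k)).
rewrite mulrDl !mulrDr !mulrnDl !mulrnAl !mulrnAr -!addrA; congr (_ + _).
by rewrite addrCA.
Qed.
Lemma pdvdnn k a : pdvd k a a. Proof. by exists 0; rewrite mul0rn addr0. Qed.
Lemma pdvdX k a b m : pdvd k a b -> pdvd k (a ^+ m) (b ^+ m).
Proof.
move=> h; elim: m => [|m ih]; first exact: pdvdnn.
by rewrite !exprS; apply: pdvdM.
Qed.
Lemma pdvd_sum k (I : Type) (r : seq I) (F G : I -> A) :
  (forall i, pdvd k (F i) (G i)) -> pdvd k (\sum_(i <- r) F i) (\sum_(i <- r) G i).
Proof.
move=> h; elim: r => [|i r ih]; first by rewrite !big_nil; apply: pdvdnn.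
by rewrite !big_cons; apply: pdvdD.
Qed.
Lemma pdvd_trans k a b c : pdvd k a b -> pdvd k b c -> pdvd k a c.
Proof. by move=> [x ->] [y ->]; exists (y + x); rewrite mulrnDl addrA. Qed.
Lemma pdvd_sym k a b : pdvd k a b -> pdvd k b a.
Proof. by move=> [x ->]; exists (- x); rewrite mulNrn addrK. Qed.

Lemma pdvd_step k a b : pdvd k.+1 a b -> pdvd k.+2 (a ^+ p) (b ^+ p).
Proof.
move=> [c ->].
rewrite exprDn big_ord_recl /= bin0 subn0 expr0 mulr1 mulr1n.
have -> : \sum_(i < p) b ^+ (p - bump 0 i) * (c *+ p ^ k.+1) ^+ bump 0 i
   *+ 'C(p, bump 0 i) = \sum_(i < p) (b ^+ (p - i.+1) * c ^+ i.+1 *+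
     ((p ^ (k.+1 * i.+1) * 'C(p, i.+1)) %/ p ^ k.+2)) *+ p ^ k.+2.
  apply: eq_bigr => i _; rewrite /bump /= add1n.
  rewrite -[in RHS]mulrnA divnK; last first.
    have [i0|i0] := posnP i.
      by rewrite i0 muln1 bin1 -expnSr.
    apply: dvdn_mulr; apply: dvdn_exp2l.
    by rewrite mulnS -[X in (X <= _)%N]addn1 leq_add2l muln_gt0.
  by rewrite exprMn_n -expnM mulrnAr mulrnA.
by rewrite sumrMnl; eexists; reflexivity.
Qed.

Lemma pdvd_pow k a b : pdvd 1 a b -> pdvd k.+1 (a ^+ (p ^ k)) (b ^+ (p ^ k)).
Proof.
move=> h; elim: k => [|k ih]; first by rewrite expn0 !expr1.
by rewrite expnSr !exprM; apply: pdvd_step.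
Qed.

Lemma pdvdpD (a b : A) : pdvd 1 ((a + b) ^+ p) (a ^+ p + b ^+ p).
Proof.
rewrite exprDn big_ord_recl /= bin0 subn0 expr0 mulr1 mulr1n.
have -> : \sum_(i < p) a ^+ (p - bump 0 i) * b ^+ bump 0 i *+ 'C(p, bump 0 i)
  = \sum_(i < p.-1.+1) a ^+ (p - i.+1) * b ^+ i.+1 *+ 'C(p, i.+1).
  by rewrite (prednK p0).
rewrite big_ord_recr /= (prednK p0) subnn expr0 mul1r binn mulr1n.
exists (\sum_(i < p.-1) (a ^+ (p - i.+1) * b ^+ i.+1 *+ ('C(p, i.+1) %/ p))).
rewrite -addrA [b ^+ p + _]addrC; congr (_ + (_ + _)).
rewrite -sumrMnl; apply: eq_bigr => i _; rewrite expn1 -mulrnA divnK //.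
by apply: prime_dvd_bin => //=; rewrite -[X in (_ < X)%N](prednK p0) ltnS.
Qed.

Lemma pdvdpN (a : A) : pdvd 1 ((- a) ^+ p) (- a ^+ p).
Proof.
have := pdvdpD a (- a); rewrite subrr expr0n eqn0Ngt p0 /= => h.
have := pdvdD (pdvdN (pdvdnn 1 (a ^+ p))) h.
by rewrite addr0 addKr => /pdvd_sym.
Qed.

Lemma pdvd_int (z : int) : pdvd 1 (z%:~R) (z%:~R ^+ p).
Proof.
elim/int_rec: z => [|m ih|m ih].
- rewrite expr0n eqn0Ngt p0; exact: pdvdnn.
- rewrite intS rmorphD /= addrC; apply: pdvd_trans (pdvd_sym (pdvdpD _ _)).
  by apply: pdvdD ih _; rewrite expr1n; exact: pdvdnn.
- rewrite intS opprD rmorphD /= addrC; apply: pdvd_trans (pdvd_sym (pdvdpD _ _)).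
  by apply: pdvdD ih _; have := pdvdpN 1; rewrite expr1n => /pdvd_sym.
Qed.

Variable n : nat.
Variable phi : {rmorphism A -> A}.
Hypothesis phi_frob : forall a, pdvd 1 (phi a) (a ^+ p).
Hypothesis torsion : forall (a : A) k, (0 < k)%N -> a *+ k = 0 -> a = 0.

Definition dworkseq (b : nat -> A) :=
  forall k, pdvd k.+1 (phi (b k)) (b k.+1).

Lemma dwork_nat (b : nat -> A) : dworkseq b -> forall m, exists x : seq A,
  size x = m /\ forall k, (k < m)%N ->
  \sum_(i < k.+1) x`_i ^+ (p ^ (k - i)) *+ (p ^ i) = b k.
Proof.
move=> hb; elim=> [|m [x [sx hx]]]; first by exists [::].
have [c hc] : exists c,
    b m = \sum_(i < m) x`_i ^+ (p ^ (m - i)) *+ (p ^ i) + c *+ p ^ m.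
  case: m sx hx => [|m] sx hx.
    by exists (b 0%N); rewrite big_ord0 add0r.
  apply: pdvd_trans (pdvd_sym (hb m)) _; rewrite -hx // rmorph_sum.
  apply: pdvd_sum => i; rewrite rmorphMn rmorphXn /=.
  rewrite subSn; last by rewrite -ltnS.
  have [d ->] := pdvd_pow (m - i) (phi_frob x`_i).
  exists d; rewrite -exprM -expnS mulrnDl -mulrnA -expnD addSn subnK // -ltnS.
  exact: ltn_ord.
exists (rcons x c); split; first by rewrite size_rcons sx.
move=> k; rewrite ltnS leq_eqVlt => /orP[/eqP ->|km].
  rewrite hc big_ord_recr /= nth_rcons sx ltnn eqxx subnn expn0 expr1; congr (_ + _).
  by apply: eq_bigr => i _; rewrite nth_rcons sx ltn_ord.
rewrite -hx //; apply: eq_bigr => i _; rewrite nth_rcons sx.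
by rewrite (leq_trans (ltn_ord i)).
Qed.

Lemma dwork_ex (b : nat -> A) : dworkseq b -> exists x : n.-tuple A,
  forall k, (k < n)%N -> ghost p x k = b k.
Proof.
move=> /dwork_nat/(_ n)[x [sx hx]].
by exists (Tuple (introT eqP sx)).
Qed.

Lemma ghost_inj (x y : n.-tuple A) :
  (forall k, (k < n)%N -> ghost p x k = ghost p y k) -> x = y.
Proof.
move=> h; suff H k : (k < n)%N -> x`_k = y`_k.
  by apply/val_inj/(@eq_from_nth _ 0) => [|i]; rewrite ?size_tuple // => /H.
elim/ltn_ind: k => k ih kn; move: (h k kn); rewrite /ghost !big_ord_recr /=.
have -> : \sum_(i < k) x`_i ^+ (p ^ (k - i)) *+ p ^ i =
          \sum_(i < k) y`_i ^+ (p ^ (k - i)) *+ p ^ i.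
  by apply: eq_bigr => i _; rewrite ih // (ltn_trans _ kn).
move/addrI; rewrite subnn expn0 !expr1 => /eqP; rewrite -subr_eq0 -mulrnBl => /eqP.
by move/torsion; rewrite expn_gt0 p0 => /(_ isT)/eqP; rewrite subr_eq0 => /eqP.
Qed.

Lemma dwork_ghost (x : n.-tuple A) : dworkseq (ghost p x).
Proof.
move=> k; rewrite rmorph_sum /ghost [in X in pdvd _ _ X]big_ord_recr /= subnn.
rewrite expn0 expr1 -[\sum_(i < k.+1) phi _]addr0.
apply: pdvdD; last by exists (- x`_k.+1); rewrite mulNrn subrr.
apply: pdvd_sum => i; rewrite rmorphMn rmorphXn /=.
rewrite subSn; last by rewrite -ltnS.
have [d ->] := pdvd_pow (k - i) (phi_frob x`_i).
exists d; rewrite -exprM -expnS mulrnDl -mulrnA -expnD addSn subnK // -ltnS.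
exact: ltn_ord.
Qed.

End Congruence.

Section FrobeniusLift.
Variables (p : nat) (pp : prime p) (N : nat).
Local Notation A := {mpoly int[N]}.
Local Notation p0 := (prime_gt0 pp).

Definition phi : A -> A := peval (fun i => 'X_i ^+ p).
HB.instance Definition _ := GRing.RMorphism.on phi.

Lemma phiX i : phi 'X_i = 'X_i ^+ p. Proof. exact: pevalX. Qed.

Lemma phi_frob (a : A) : pdvd p 1 (phi a) (a ^+ p).
Proof.
rewrite (mpolyE a); elim: (msupp a) => [|m r ih].
  rewrite big_nil rmorph0 expr0n eqn0Ngt p0; exact: pdvdnn.
rewrite big_cons rmorphD; apply: pdvd_trans (pdvd_sym (pdvdpD pp _ _)).
apply: pdvdD ih; rewrite -mul_mpolyC rmorphM exprMn; apply: pdvdM.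
  rewrite -[in (_)%:MP](intz a@_m) rmorph_int rmorph_int; exact: pdvd_int.
rewrite mpolyXE_id rmorph_prod -prodrXl.
apply: (big_ind2 (pdvd p 1)); first exact: pdvdnn.
  by move=> x1 x2 y1 y2; exact: pdvdM.
move=> i _; rewrite rmorphXn /= phiX -!exprM mulnC; exact: pdvdnn.
Qed.
End FrobeniusLift.
(* Z[X_i | i < N] behind an opaque interface: conversion in {mpoly int[N]} does
   not terminate in practice. *)
Record freeRing (p N : nat) := FreeRing {
  free_sort :> comPzRingType;
  free_var : 'I_N -> free_sort;
  free_eval : forall R : comPzRingType, ('I_N -> R) -> {rmorphism free_sort -> R};
  free_lift : {rmorphism free_sort -> free_sort};
  free_evalX : forall (R : comPzRingType) (v : 'I_N -> R) i,
    free_eval v (free_var i) = v i;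
  free_eq : forall (R : comPzRingType) (f g : {rmorphism free_sort -> R}),
    (forall i, f (free_var i) = g (free_var i)) -> f =1 g;
  free_torsion : forall (a : free_sort) k, (0 < k)%N -> a *+ k = 0 -> a = 0;
  free_liftP : forall a, pdvd p 1 (free_lift a) (a ^+ p)
}.

Lemma free (p : nat) (pp : prime p) (N : nat) : freeRing p N.
Proof.
exact: (@FreeRing p N {mpoly int[N]} (fun i => 'X_i)
  (fun R v => peval v) (@phi p N) (fun R v => pevalX v)
  (fun R f g => @rmorph_mpoly_eq N R f g) (fun a k => @mpoly_torsion N a k)
  (fun a => phi_frob pp a)).
Qed.

Section Laws.
Variables (p : nat) (pp : prime p) (n : nat).
Local Notation A := (free pp (n + n + n)).

Definition genX : n.-tuple A := [tuple free_var A (lshift n (lshift n i)) | i < n].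
Definition genY : n.-tuple A := [tuple free_var A (lshift n (rshift n i)) | i < n].
Definition genZ : n.-tuple A := [tuple free_var A (rshift (n + n) i) | i < n].

Definition spec (R : comPzRingType) (x y z : n.-tuple R) : {rmorphism A -> R} :=
  free_eval A (fun j => match split j with
    | inl j' => match split j' with inl i => tnth x i | inr i => tnth y i end
    | inr i => tnth z i
    end).

Lemma lshiftK (a b : nat) (i : 'I_a) : split (lshift b i) = inl i.
Proof. exact: (unsplitK (inl i)). Qed.
Lemma rshiftK (a b : nat) (i : 'I_b) : split (rshift a i) = inr i.
Proof. exact: (unsplitK (inr i)). Qed.

Lemma specX (R : comPzRingType) (x y z : n.-tuple R) :
  [tuple of map (spec x y z) genX] = x.
Proof.
by apply: eq_from_tnth => i; rewrite !tnth_map /= tnth_ord_tuple /spec free_evalX !lshiftK.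
Qed.
Lemma specY (R : comPzRingType) (x y z : n.-tuple R) :
  [tuple of map (spec x y z) genY] = y.
Proof.
by apply: eq_from_tnth => i; rewrite !tnth_map /= tnth_ord_tuple /spec free_evalX lshiftK rshiftK.
Qed.
Lemma specZ (R : comPzRingType) (x y z : n.-tuple R) :
  [tuple of map (spec x y z) genZ] = z.
Proof.
by apply: eq_from_tnth => i; rewrite !tnth_map /= tnth_ord_tuple /spec free_evalX rshiftK.
Qed.

Lemma map_spec (R S : comPzRingType) (f : {rmorphism R -> S}) (x y z : n.-tuple R) :
  f \o spec x y z =1
  spec [tuple of map f x] [tuple of map f y] [tuple of map f z].
Proof.
apply: (free_eq (f := f \o spec x y z)) => i /=; rewrite /spec !free_evalX.
by case: split => [j|j]; [case: split => k|]; rewrite tnth_map.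
Qed.

Lemma exists_law (b : nat -> A) :
  (forall k, pdvd p k.+1 (free_lift A (b k)) (b k.+1)) ->
  exists x : n.-tuple A, forall k, (k < n)%N -> ghost p x k = b k.
Proof. refine (@dwork_ex p _ n (free_lift A) (@free_liftP p _ A) b). Qed.

Lemma gen_dwork (x : n.-tuple A) k :
  pdvd p k.+1 (free_lift A (ghost p x k)) (ghost p x k.+1).
Proof. refine (dwork_ghost (phi := free_lift A) _ x k); exact: free_liftP. Qed.

Lemma add_ex : exists s : n.-tuple A, forall k, (k < n)%N ->
  ghost p s k = ghost p genX k + ghost p genY k.
Proof. by apply: exists_law => k; rewrite rmorphD; apply: pdvdD; apply: gen_dwork. Qed.
Lemma mul_ex : exists s : n.-tuple A, forall k, (k < n)%N ->
  ghost p s k = ghost p genX k * ghost p genY k.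
Proof. by apply: exists_law => k; rewrite rmorphM; apply: pdvdM; apply: gen_dwork. Qed.
Lemma opp_ex : exists s : n.-tuple A, forall k, (k < n)%N ->
  ghost p s k = - ghost p genX k.
Proof. by apply: exists_law => k; rewrite rmorphN; apply: pdvdN; apply: gen_dwork. Qed.

(* The integer polynomials giving the ring laws; they are determined by the
   ghost components (ghost_inj). *)
Definition addpol : n.-tuple A := projT1 (cid add_ex).
Definition mulpol : n.-tuple A := projT1 (cid mul_ex).
Definition opppol : n.-tuple A := projT1 (cid opp_ex).

Lemma addpolE k : (k < n)%N -> ghost p addpol k = ghost p genX k + ghost p genY k.
Proof. exact: (projT2 (cid add_ex)). Qed.
Lemma mulpolE k : (k < n)%N -> ghost p mulpol k = ghost p genX k * ghost p genY k.
Proof. exact: (projT2 (cid mul_ex)). Qed.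
Lemma opppolE k : (k < n)%N -> ghost p opppol k = - ghost p genX k.
Proof. exact: (projT2 (cid opp_ex)). Qed.

Section Ops.
Variable R : comPzRingType.
Definition zero : n.-tuple R := [tuple 0 | i < n].
Definition one : n.-tuple R := [tuple (i == 0%N :> nat)%:R | i < n].
Definition add (x y : n.-tuple R) : n.-tuple R := [tuple of map (spec x y zero) addpol].
Definition mul (x y : n.-tuple R) : n.-tuple R := [tuple of map (spec x y zero) mulpol].
Definition opp (x : n.-tuple R) : n.-tuple R := [tuple of map (spec x zero zero) opppol].

Lemma ghost_add x y k : (k < n)%N -> ghost p (add x y) k = ghost p x k + ghost p y k.
Proof.
by move=> kn; rewrite /add ghost_map addpolE // rmorphD -!ghost_map specX specY.
Qed.
Lemma ghost_mul x y k : (k < n)%N -> ghost p (mul x y) k = ghost p x k * ghost p y k.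
Proof.
by move=> kn; rewrite /mul ghost_map mulpolE // rmorphM -!ghost_map specX specY.
Qed.
Lemma ghost_opp x k : (k < n)%N -> ghost p (opp x) k = - ghost p x k.
Proof.
by move=> kn; rewrite /opp ghost_map opppolE // rmorphN -!ghost_map specX.
Qed.
Lemma ghost_zero k : ghost p zero k = 0.
Proof.
rewrite /ghost big1 // => i _; have -> : zero`_i = 0.
  have [h|h] := ltnP i n; last by rewrite nth_default ?size_tuple.
  by rewrite -(tnth_nth _ zero (Ordinal h)) tnth_map.
by rewrite expr0n expn_eq0 eqn0Ngt prime_gt0 //= mul0rn.
Qed.
Lemma ghost_one k : (k < n)%N -> ghost p one k = 1.
Proof.
move=> kn; rewrite /ghost big_ord_recl /= big1 => [|i _].
  have n0 := leq_ltn_trans (leq0n k) kn.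
  by rewrite -(tnth_nth _ one (Ordinal n0)) tnth_map tnth_ord_tuple /= expr1n addr0.
have -> : one`_(bump 0 i) = 0.
  have [h|h] := ltnP (bump 0 i) n; last by rewrite nth_default ?size_tuple.
  by rewrite -(tnth_nth _ one (Ordinal h)) tnth_map tnth_ord_tuple.
by rewrite expr0n expn_eq0 eqn0Ngt prime_gt0 //= mul0rn.
Qed.
End Ops.

Section Map.
Variables (R S : comPzRingType) (f : {rmorphism R -> S}).
Lemma map_zero : [tuple of map f (zero R)] = zero S.
Proof. by apply: eq_from_tnth => i; rewrite !tnth_map rmorph0. Qed.
Lemma map_one : [tuple of map f (one R)] = one S.
Proof. by apply: eq_from_tnth => i; rewrite !tnth_map /= rmorph_nat. Qed.
Lemma map_add x y :
  [tuple of map f (add x y)] = add [tuple of map f x] [tuple of map f y].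
Proof.
by apply: eq_from_tnth => i; rewrite !tnth_map -map_zero -map_spec.
Qed.
Lemma map_mul x y :
  [tuple of map f (mul x y)] = mul [tuple of map f x] [tuple of map f y].
Proof.
by apply: eq_from_tnth => i; rewrite !tnth_map -map_zero -map_spec.
Qed.
Lemma map_opp x : [tuple of map f (opp x)] = opp [tuple of map f x].
Proof.
by apply: eq_from_tnth => i; rewrite !tnth_map -map_zero -map_spec.
Qed.
End Map.

Definition ghostE := (ghost_add, ghost_mul, ghost_opp, ghost_zero, ghost_one).
Lemma gen_inj (x y : n.-tuple A) :
  (forall k, (k < n)%N -> ghost p x k = ghost p y k) -> x = y.
Proof. by apply: (ghost_inj pp); apply: free_torsion. Qed.

Section Identities.
Variable R : comPzRingType.
Implicit Types x y z : n.-tuple R.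

(* An identity between Witt vectors holds as soon as it holds for generic ones. *)
Lemma generic x y z (P : forall S : comPzRingType, n.-tuple S -> n.-tuple S ->
    n.-tuple S -> n.-tuple S) (Q : forall S : comPzRingType, n.-tuple S ->
    n.-tuple S -> n.-tuple S -> n.-tuple S) :
  (forall (S T : comPzRingType) (f : {rmorphism S -> T}) a b c,
     [tuple of map f (P S a b c)] =
     P T [tuple of map f a] [tuple of map f b] [tuple of map f c]) ->
  (forall (S T : comPzRingType) (f : {rmorphism S -> T}) a b c,
     [tuple of map f (Q S a b c)] =
     Q T [tuple of map f a] [tuple of map f b] [tuple of map f c]) ->
  (forall a b c k, (k < n)%N -> ghost p (P A a b c) k = ghost p (Q A a b c) k) ->
  P R x y z = Q R x y z.
Proof.
move=> hP hQ h; have := hP _ _ (spec x y z) genX genY genZ.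
have := hQ _ _ (spec x y z) genX genY genZ.
rewrite specX specY specZ => <- <-; congr [tuple of map _ _].
exact/gen_inj/h.
Qed.

Definition mapE := (map_add, map_mul, map_opp, map_zero, map_one).

Lemma addA x y z : add x (add y z) = add (add x y) z.
Proof.
apply: (generic x y z (P := fun S a b c => add a (add b c))
  (Q := fun S a b c => add (add a b) c)) => [*|*|a b c k kn].
- by rewrite !mapE.
- by rewrite !mapE.
- by rewrite !ghostE // addrA.
Qed.
Lemma addC x y : add x y = add y x.
Proof.
apply: (generic x y y (P := fun S a b c => add a b)
  (Q := fun S a b c => add b a)) => [*|*|a b c k kn].
- by rewrite !mapE.
- by rewrite !mapE.
- by rewrite !ghostE // addrC.
Qed.
Lemma add0 x : add (zero R) x = x.
Proof.
apply: (generic x x x (P := fun S a b c => add (zero S) a)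
  (Q := fun S a b c => a)) => [*|*|a b c k kn].
- by rewrite !mapE.
- by [].
- by rewrite !ghostE // add0r.
Qed.
Lemma addN x : add (opp x) x = zero R.
Proof.
apply: (generic x x x (P := fun S a b c => add (opp a) a)
  (Q := fun S a b c => zero S)) => [*|*|a b c k kn].
- by rewrite !mapE.
- by rewrite !mapE.
- by rewrite !ghostE // addNr.
Qed.
Lemma mulA x y z : mul x (mul y z) = mul (mul x y) z.
Proof.
apply: (generic x y z (P := fun S a b c => mul a (mul b c))
  (Q := fun S a b c => mul (mul a b) c)) => [*|*|a b c k kn].
- by rewrite !mapE.
- by rewrite !mapE.
- by rewrite !ghostE // mulrA.
Qed.
Lemma mulC x y : mul x y = mul y x.
Proof.
apply: (generic x y y (P := fun S a b c => mul a b)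
  (Q := fun S a b c => mul b a)) => [*|*|a b c k kn].
- by rewrite !mapE.
- by rewrite !mapE.
- by rewrite !ghostE // mulrC.
Qed.
Lemma mul1 x : mul (one R) x = x.
Proof.
apply: (generic x x x (P := fun S a b c => mul (one S) a)
  (Q := fun S a b c => a)) => [*|*|a b c k kn].
- by rewrite !mapE.
- by [].
- by rewrite !ghostE // mul1r.
Qed.
Lemma mulDl x y z : mul (add x y) z = add (mul x z) (mul y z).
Proof.
apply: (generic x y z (P := fun S a b c => mul (add a b) c)
  (Q := fun S a b c => add (mul a c) (mul b c))) => [*|*|a b c k kn].
- by rewrite !mapE.
- by rewrite !mapE.
- by rewrite !ghostE // mulrDl.
Qed.

End Identities.
End Laws.
End Witt.

Definition witt (p : nat) (pp : prime p) (n : nat) (R : comPzRingType) : Type :=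
  n.-tuple R.

HB.instance Definition _ p pp n R := Choice.on (@witt p pp n R).
HB.instance Definition _ p (pp : prime p) n R := GRing.isZmodule.Build (witt pp n R)
  (@Witt.addA p pp n R) (@Witt.addC p pp n R) (@Witt.add0 p pp n R)
  (@Witt.addN p pp n R).
HB.instance Definition _ p (pp : prime p) n R :=
  GRing.Zmodule_isComPzRing.Build (witt pp n R)
  (@Witt.mulA p pp n R) (@Witt.mulC p pp n R) (@Witt.mul1 p pp n R)
  (@Witt.mulDl p pp n R).

(* These characterise the ring structure, as p is a nonzerodivisor in the
   integer polynomial rings over which it is universally defined. *)
Lemma ghost_wittD p (pp : prime p) n (R : comPzRingType) (x y : witt pp n R) k :
  (k < n)%N -> Witt.ghost p (x + y) k = Witt.ghost p x k + Witt.ghost p y k.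
Proof. exact: Witt.ghost_add. Qed.
Lemma ghost_wittM p (pp : prime p) n (R : comPzRingType) (x y : witt pp n R) k :
  (k < n)%N -> Witt.ghost p (x * y) k = Witt.ghost p x k * Witt.ghost p y k.
Proof. exact: Witt.ghost_mul. Qed.

Section WittMaps.
Variables (p : nat) (pp : prime p) (n : nat).

Definition witt_map (R S : comPzRingType) (f : R -> S) (x : witt pp n R) :
  witt pp n S := [tuple of map f x].

Lemma witt_map_zmod (R S : comPzRingType) (f : {rmorphism R -> S}) :
  zmod_morphism (witt_map f).
Proof.
move=> x y; rewrite /witt_map.
have -> : x - y = Witt.add pp x (Witt.opp pp y) by [].
by rewrite Witt.map_add Witt.map_opp.
Qed.
Lemma witt_map_monoid (R S : comPzRingType) (f : {rmorphism R -> S}) :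
  monoid_morphism (witt_map f).
Proof. by split; [exact: Witt.map_one|move=> x y; exact: Witt.map_mul]. Qed.
HB.instance Definition _ (R S : comPzRingType) (f : {rmorphism R -> S}) :=
  GRing.isZmodMorphism.Build _ _ (witt_map f) (witt_map_zmod f).
HB.instance Definition _ (R S : comPzRingType) (f : {rmorphism R -> S}) :=
  GRing.isMonoidMorphism.Build _ _ (witt_map f) (witt_map_monoid f).

(* R^(n-1) : W_n -> W_1, with W_1 identified with the base ring. *)
Variable n_gt0 : (0 < n)%N.
Definition witt_fst (R : comPzRingType) (x : witt pp n R) : R :=
  tnth x (Ordinal n_gt0).

Lemma witt_fst_ghost (R : comPzRingType) (x : witt pp n R) :
  witt_fst x = Witt.ghost p x 0.
Proof. by rewrite /Witt.ghost /witt_fst big_ord1 expn0 expr1 (tnth_nth 0). Qed.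

Lemma witt_fst_zmod (R : comPzRingType) : zmod_morphism (@witt_fst R).
Proof.
move=> x y; rewrite !witt_fst_ghost ghost_wittD //; congr (_ + _).
exact: Witt.ghost_opp.
Qed.
Lemma witt_fst_monoid (R : comPzRingType) : monoid_morphism (@witt_fst R).
Proof.
split; first by rewrite witt_fst_ghost; exact: Witt.ghost_one.
by move=> x y; rewrite !witt_fst_ghost ghost_wittM.
Qed.
HB.instance Definition _ (R : comPzRingType) :=
  GRing.isZmodMorphism.Build _ _ (@witt_fst R) (@witt_fst_zmod R).
HB.instance Definition _ (R : comPzRingType) :=
  GRing.isMonoidMorphism.Build _ _ (@witt_fst R) (@witt_fst_monoid R).
End WittMaps.

From mathcomp Require Import classical_sets topology.

Local Open Scope classical_set_scope.

(* Rings are [comPzRingType]: a sheaf of rings takes the value 0 on the empty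
   open. *)

Section Ideals.
Variable R : comPzRingType.

Definition ideal (I : set R) : Prop :=
  [/\ I 0, forall x y, I x -> I y -> I (x + y) & forall a x, I x -> I (a * x)].

Definition prime_ideal (P : set R) : Prop :=
  [/\ ideal P, ~ P 1 & forall x y, P (x * y) -> P x \/ P y].

Definition ideal_gen (G : set R) : set R :=
  [set x | forall I, ideal I -> G `<=` I -> I x].

Fixpoint ideal_pow (I : set R) (n : nat) : set R :=
  if n is m.+1 then
    ideal_gen [set x | exists a b, [/\ I a, ideal_pow I m b & x = a * b]]
  else setT.

Definition noetherian_ring : Prop :=
  forall I, ideal I -> exists s : seq R, I = ideal_gen [set` s].

Definition domain : Prop := (1 : R) <> 0 /\ GRing.integral_domain_axiom R.

Definition invertible (x : R) : Prop := exists y, x * y = 1.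

End Ideals.

(* Z 0 < Z 1 < ... < Z n in P, strictly increasing. *)
Definition chain (S : Type) (P : set (set S)) (n : nat) (Z : nat -> set S) : Prop :=
  (forall i, (i <= n)%N -> P (Z i)) /\
  (forall i, (i < n)%N -> Z i `<` Z i.+1).

Definition krull_dim (R : comPzRingType) (d : nat) : Prop :=
  (exists Z, chain (@prime_ideal R) d Z) /\
  (forall n Z, chain (@prime_ideal R) n Z -> (n <= d)%N).

(* f : R -> L identifies L with the localisation of R at S. *)
Definition is_localization (R L : comPzRingType) (S : set R) (f : R -> L) : Prop :=
  [/\ forall s, S s -> invertible (f s),
      forall z, exists a s, S s /\ f s * z = f a &
      forall a, f a = 0 -> exists2 s, S s & s * a = 0].

Definition is_localization_at (R L : comPzRingType) (P : set R) (f : R -> L) :=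
  is_localization (~` P) f.

Definition regular_local (R : comPzRingType) : Prop :=
  noetherian_ring R /\
  let m := [set x : R | ~ invertible x] in
  ideal m /\
  exists d, krull_dim R d /\
    exists s : seq R, size s = d /\ m = ideal_gen [set` s].

Definition regular_at (R : comPzRingType) (P : set R) : Prop :=
  exists (L : comPzRingType) (f : {rmorphism R -> L}),
    is_localization_at P f /\ regular_local L.

Definition regular_ring (R : comPzRingType) : Prop :=
  noetherian_ring R /\ forall P : set R, prime_ideal P -> regular_at P.

Definition finite_type_alg (R B : comPzRingType) (f : R -> B) : Prop :=
  exists s : seq B, forall C : set B,
    C 1 -> (forall x y, C x -> C y -> C (x - y)) ->
    (forall x y, C x -> C y -> C (x * y)) ->
    range f `<=` C -> [set` s] `<=` C -> C = setT.

Definition saturated_chain (R : comPzRingType) (P Q : set R) n Z : Prop :=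
  [/\ chain (@prime_ideal R) n Z, Z 0%N = P, Z n = Q &
      forall i, (i < n)%N ->
        ~ exists2 P' : set R, prime_ideal P' & Z i `<` P' /\ P' `<` Z i.+1].

Definition catenary (R : comPzRingType) : Prop :=
  forall P Q : set R, prime_ideal P -> prime_ideal Q -> P `<=` Q ->
    (exists b, forall n Z, chain (@prime_ideal R) n Z -> Z 0%N = P -> Z n = Q ->
       (n <= b)%N) /\
    (forall n Z n' Z', saturated_chain P Q n Z -> saturated_chain P Q n' Z' -> n = n').

Definition universally_catenary (R : comPzRingType) : Prop :=
  noetherian_ring R /\
  forall (B : comPzRingType) (f : {rmorphism R -> B}), finite_type_alg f -> catenary B.

Definition regular_locus_open (R : comPzRingType) : Prop :=
  forall P : set R, prime_ideal P -> regular_at P ->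
    exists2 g, ~ P g &
      forall Q : set R, prime_ideal Q -> ~ Q g -> regular_at Q.

Definition J2_ring (R : comPzRingType) : Prop :=
  forall (B : comPzRingType) (f : {rmorphism R -> B}),
    finite_type_alg f -> regular_locus_open B.

(* C = lim_n R / I^n, for a finitely generated ideal I. *)
Definition is_completion (R C : comPzRingType) (I : set R) (c : R -> C) : Prop :=
  let J n := ideal_gen (c @` ideal_pow I n) in
  [/\ forall n a, J n (c a) -> ideal_pow I n a,
      forall n y, exists a, J n (y - c a),
      forall y, (forall n, J n y) -> y = 0 &
      forall u : nat -> C, (forall n, J n (u n.+1 - u n)) ->
        exists y, forall n, J n (y - u n)].

Definition is_residue_field (R : comPzRingType) (q : set R) (k : fieldType)
    (f : R -> k) : Prop :=
  (forall a, f a = 0 <-> q a) /\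
  (forall z, exists a b, f b != 0 /\ z = f a / f b).

(* T = B (x)_A C, as a pushout of commutative rings. *)
Definition is_tensor (A B C T : comPzRingType) (f : A -> B) (g : A -> C)
    (i : B -> T) (j : C -> T) : Prop :=
  (forall a, i (f a) = j (g a)) /\
  forall (D : comPzRingType) (u : {rmorphism B -> D}) (v : {rmorphism C -> D}),
    (forall a, u (f a) = v (g a)) ->
    exists w : {rmorphism T -> D},
      [/\ forall b, w (i b) = u b, forall c, w (j c) = v c &
          forall w' : {rmorphism T -> D},
            (forall b, w' (i b) = u b) -> (forall c, w' (j c) = v c) -> w' =1 w].

Definition geometrically_regular (k : fieldType) (B : comPzRingType) (f : k -> B) :=
  forall K : fieldExtType k,
    exists (T : comPzRingType) (i : {rmorphism B -> T}) (j : {rmorphism K -> T}),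
      is_tensor f (in_alg K) i j /\ regular_ring T.

(* For every prime P, the map from L = R_P to its completion C is regular:
   the fibre of C at every prime of L is geometrically regular.  Flatness of
   L -> C is automatic, L being Noetherian. *)
Definition G_ring (R : comPzRingType) : Prop :=
  noetherian_ring R /\
  forall P : set R, prime_ideal P ->
    exists (L : comPzRingType) (l : {rmorphism R -> L})
           (C : comPzRingType) (c : {rmorphism L -> C}),
      [/\ is_localization_at P l,
          is_completion [set x | ~ invertible x] c &
          forall q : set L, prime_ideal q ->
            exists (k : fieldType) (r : {rmorphism L -> k})
                   (B : comPzRingType) (i : {rmorphism C -> B})
                   (j : {rmorphism k -> B}),
              [/\ is_residue_field q r, is_tensor c r i j &
                  geometrically_regular j]].

Definition excellent_ring (R : comPzRingType) : Prop :=
  [/\ noetherian_ring R, G_ring R, J2_ring R & universally_catenary R].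

Record opens (T : topologicalType) := Opens { oset :> set T; oset_open : open oset }.

Definition oset_mem (T : topologicalType) (U : opens T) : T -> Prop := oset U.
Coercion oset_mem : opens >-> Funclass.

(* Unique gluing; taking I empty, F is a singleton on the empty open. *)
Definition sheaf_axiom (T : topologicalType) (F : opens T -> Type)
    (res : forall U V : opens T, V `<=` U -> F U -> F V) : Prop :=
  forall (U : opens T) (I : Type) (V : I -> opens T) (VU : forall i, V i `<=` U),
    U `<=` \bigcup_i V i ->
    forall s : forall i, F (V i),
      (forall i j (W : opens T) (Wi : W `<=` V i) (Wj : W `<=` V j),
         res _ _ Wi (s i) = res _ _ Wj (s j)) ->
      exists! t : F U, forall i, res _ _ (VU i) t = s i.

Record ringSheaf (T : topologicalType) := RingSheaf {
  rsec :> opens T -> comPzRingType;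
  rres : forall U V : opens T, V `<=` U -> {rmorphism rsec U -> rsec V};
  rres_id : forall (U : opens T) (UU : U `<=` U) s, rres UU s = s;
  rres_comp : forall (U V W : opens T) (VU : V `<=` U) (WV : W `<=` V)
    (WU : W `<=` U) s, rres WV (rres VU s) = rres WU s;
  rres_sheaf : sheaf_axiom (F := rsec) (fun U V VU => rres VU)
}.

Arguments rres {T r U V} VU.

Record rsHom (T : topologicalType) (A B : ringSheaf T) := RsHom {
  rsmap :> forall U, {rmorphism A U -> B U};
  rsmap_res : forall (U V : opens T) (VU : V `<=` U) s,
    rres VU (rsmap U s) = rsmap V (rres VU s)
}.

Section RsHom.
Variables (T : topologicalType).

Program Definition rs_id (A : ringSheaf T) : rsHom A A := {| rsmap := fun U => idfun |}.
Next Obligation. by []. Qed.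

Program Definition rs_comp (A B C : ringSheaf T) (g : rsHom B C) (f : rsHom A B) :
  rsHom A C := {| rsmap := fun U => g U \o f U |}.
Next Obligation. by move=> A B C g f U V VU s; rewrite /= !rsmap_res. Qed.

Fixpoint rs_iter (A : ringSheaf T) (f : rsHom A A) (e : nat) : rsHom A A :=
  if e is d.+1 then rs_comp f (rs_iter f d) else rs_id A.

End RsHom.

Record modSheaf (T : topologicalType) (A : ringSheaf T) := ModSheaf {
  msec :> forall U : opens T, lmodType (A U);
  mres : forall U V : opens T, V `<=` U -> {additive msec U -> msec V};
  mresZ : forall (U V : opens T) (VU : V `<=` U) (a : A U) s,
    mres VU (a *: s) = rres VU a *: mres VU s;
  mres_id : forall (U : opens T) (UU : U `<=` U) s, mres UU s = s;
  mres_comp : forall (U V W : opens T) (VU : V `<=` U) (WV : W `<=` V)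
    (WU : W `<=` U) s, mres WV (mres VU s) = mres WU s;
  mres_sheaf : sheaf_axiom (F := msec) (fun U V VU => mres VU)
}.

Arguments mres {T A m U V} VU.

Record modHom (T : topologicalType) (A : ringSheaf T) (M N : modSheaf A) := ModHom {
  mhom :> forall U, {linear M U -> N U};
  mhom_res : forall (U V : opens T) (VU : V `<=` U) s,
    mres VU (mhom U s) = mhom V (mres VU s)
}.

Definition splits (T : topologicalType) (A : ringSheaf T) (M N : modSheaf A)
    (f : modHom M N) : Prop :=
  exists r : modHom N M, forall U s, r U (f U s) = s.

Definition is_pushout (T : topologicalType) (A : ringSheaf T) (M N L Q : modSheaf A)
    (f : modHom M N) (g : modHom M L) (i : modHom N Q) (j : modHom L Q) : Prop :=
  (forall U s, i U (f U s) = j U (g U s)) /\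
  forall (P : modSheaf A) (u : modHom N P) (v : modHom L P),
    (forall U s, u U (f U s) = v U (g U s)) ->
    exists w : modHom Q P,
      [/\ forall U s, w U (i U s) = u U s, forall U s, w U (j U s) = v U s &
          forall w' : modHom Q P,
            (forall U s, w' U (i U s) = u U s) ->
            (forall U s, w' U (j U s) = v U s) -> forall U, w' U =1 w U].

Definition via (R S : comPzRingType) (f : {rmorphism R -> S}) : Type := S.

Section Via.
Variables (R S : comPzRingType) (f : {rmorphism R -> S}).
HB.instance Definition _ := GRing.Zmodule.on (via f).
Definition via_scale (a : R) (s : via f) : via f := f a * s.
Lemma via_scaleA a b s : via_scale a (via_scale b s) = via_scale (a * b) s.
Proof. by rewrite /via_scale rmorphM mulrA. Qed.
Lemma via_scale1 : left_id 1 via_scale.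
Proof. by move=> s; rewrite /via_scale rmorph1 mul1r. Qed.
Lemma via_scaleDr : right_distributive via_scale +%R.
Proof. by move=> a s t; rewrite /via_scale mulrDr. Qed.
Lemma via_scaleDl s : {morph via_scale^~ s : a b / a + b}.
Proof. by move=> a b; rewrite /via_scale rmorphD mulrDl. Qed.
HB.instance Definition _ := GRing.Zmodule_isLmodule.Build R (via f)
  via_scaleA via_scale1 via_scaleDr via_scaleDl.
End Via.

Section ModVia.
Variables (T : topologicalType) (A B : ringSheaf T) (f : rsHom A B).

Definition via_res (U V : opens T) (VU : V `<=` U) : via (f U) -> via (f V) := rres VU.
Lemma via_res_zmod U V VU : zmod_morphism (@via_res U V VU).
Proof. by move=> s t; apply: rmorphB. Qed.
HB.instance Definition _ U V VU :=
  GRing.isZmodMorphism.Build _ _ (@via_res U V VU) (via_res_zmod VU).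

(* B as an A-module via f; this is also the pushforward f_*B along a morphism
   of ringed spaces that is the identity on points. *)
Program Definition mod_via : modSheaf A :=
  {| msec := fun U => via (f U); mres := fun U V VU => @via_res U V VU |}.
Next Obligation.
move=> U V VU a s.
transitivity (rres VU (f U a) * rres VU s); first exact: rmorphM.
by rewrite rsmap_res.
Qed.
Next Obligation. by move=> U UU s; apply: rres_id. Qed.
Next Obligation. by move=> U V W VU WV WU s; apply: rres_comp. Qed.
Next Obligation. exact: rres_sheaf. Qed.

End ModVia.

Definition mod_self (T : topologicalType) (A : ringSheaf T) : modSheaf A :=
  mod_via (rs_id A).

Section HomVia.
Variables (T : topologicalType) (A B : ringSheaf T) (f : rsHom A B).

Definition via_map (U : opens T) : mod_self A U -> mod_via f U := f U.
Lemma via_map_linear U : linear (@via_map U).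
Proof.
move=> a s t; transitivity (f U (a * s) + f U t); first exact: rmorphD.
by rewrite rmorphM.
Qed.
HB.instance Definition _ U := GRing.isLinear.Build _ _ _ _ (@via_map U)
  (@via_map_linear U).

Program Definition hom_via : modHom (mod_self A) (mod_via f) :=
  {| mhom := fun U => @via_map U |}.
Next Obligation. by move=> U V VU s; apply: rsmap_res. Qed.

End HomVia.

Record ringedSpace := RingedSpace {
  rspace :> topologicalType;
  rstruct : ringSheaf rspace
}.

(* (U, O|U) is the spectrum of the ring R: h is a homeomorphism of U onto the
   set of primes of R with its Zariski topology, and on the basic open D(f) the
   structure sheaf takes the value R_f, compatibly with R. *)
Definition affine (X : ringedSpace) (U : opens X) : Prop :=
  exists (R : comPzRingType) (h : X -> set R) (phi : {rmorphism R -> rstruct X U}),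
    [/\ forall x, U x -> prime_ideal (h x),
        forall P, prime_ideal P -> exists! x, U x /\ h x = P,
        forall W : set X, W `<=` U ->
          (open W <->
           exists E : set R, W = [set x | U x /\ exists2 f, E f & ~ h x f]) &
        forall (f : R) (V : opens X) (VU : V `<=` U),
          V = [set x | U x /\ ~ h x f] :> set X ->
          is_localization (range (fun n => f ^+ n)) (fun a => rres VU (phi a))].

(* A ringed space that is locally affine has local stalks. *)
Definition scheme (X : ringedSpace) : Prop :=
  forall x : X, exists2 U : opens X, U x & affine U.

Definition char_p (p : nat) (T : topologicalType) (A : ringSheaf T) : Prop :=
  forall U, p%:R = 0 :> A U.

Definition noetherian_scheme (X : ringedSpace) : Prop :=
  compact [set: X] /\
  forall x : X, exists U : opens X,
    [/\ U x, affine U & noetherian_ring (rstruct X U)].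

Definition integral_scheme (X : ringedSpace) : Prop :=
  [set: X] !=set0 /\ forall U : opens X, U !=set0 -> domain (rstruct X U).

Definition irreducible_closed (T : topologicalType) (Z : set T) : Prop :=
  [/\ closed Z, Z !=set0 &
      forall A B : set T, closed A -> closed B -> Z `<=` A `|` B ->
        Z `<=` A \/ Z `<=` B].

Definition finite_dimensional (T : topologicalType) : Prop :=
  exists d, forall n Z, chain (@irreducible_closed T) n Z -> (n <= d)%N.

Definition is_stalk (T : topologicalType) (A : ringSheaf T) (x : T)
    (S : comPzRingType) (germ : forall U : opens T, U x -> {rmorphism A U -> S}) :=
  [/\ forall (U V : opens T) (Ux : U x) (Vx : V x) (VU : V `<=` U) s,
        germ V Vx (rres VU s) = germ U Ux s,
      forall z, exists (U : opens T) (Ux : U x) (s : A U), germ U Ux s = z &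
      forall (U : opens T) (Ux : U x) s, germ U Ux s = 0 ->
        exists (V : opens T) (VU : V `<=` U), V x /\ rres VU s = 0].

Definition integrally_closed (S : idomainType) : Prop :=
  forall z : {fraction S}, integralOver (@tofrac S) z -> exists s : S, z = tofrac s.

Definition normal_scheme (X : ringedSpace) : Prop :=
  forall x : X, exists (S : idomainType)
      (germ : forall U : opens X, U x -> {rmorphism rstruct X U -> S}),
    is_stalk germ /\ integrally_closed S.

(* The absolute Frobenius is the identity on points, so it is finite exactly
   when O(U) is a finite module over itself via Frobenius for U affine. *)
Definition F_finite (p : nat) (X : ringedSpace) : Prop :=
  forall U : opens X, affine U ->
    exists (n : nat) (g : 'I_n -> rstruct X U), forall b,
      exists c : 'I_n -> rstruct X U, b = \sum_(i < n) c i ^+ p * g i.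

Definition excellent_scheme (X : ringedSpace) : Prop :=
  forall x : X, exists U : opens X,
    [/\ U x, affine U & excellent_ring (rstruct X U)].

Section Coherent.
Variables (T : topologicalType) (A : ringSheaf T) (M : modSheaf A).

Definition generate (V : opens T) (n : nat) (s : 'I_n -> M V) : Prop :=
  forall (W : opens T) (WV : W `<=` V) (t : M W) x, W x ->
    exists (W' : opens T) (W'W : W' `<=` W) (W'V : W' `<=` V) (c : 'I_n -> A W'),
      W' x /\ mres W'W t = \sum_(i < n) c i *: mres W'V (s i).

Definition finite_type : Prop :=
  forall x : T, exists (V : opens T) (n : nat) (s : 'I_n -> M V),
    V x /\ generate s.

(* The kernel of A^n|U -> M|U defined by s is of finite type. *)
Definition relations_finite_type (U : opens T) (n : nat) (s : 'I_n -> M U) : Prop :=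
  forall x, U x -> exists (V : opens T) (VU : V `<=` U) (r : nat)
      (c : 'I_r -> 'I_n -> A V),
    [/\ V x,
        forall k, \sum_(i < n) c k i *: mres VU (s i) = 0 &
        forall (W : opens T) (WV : W `<=` V) (WU : W `<=` U) (b : 'I_n -> A W),
          \sum_(i < n) b i *: mres WU (s i) = 0 ->
          forall y, W y -> exists (W' : opens T) (W'W : W' `<=` W)
              (W'V : W' `<=` V) (e : 'I_r -> A W'),
            W' y /\ forall i, rres W'W (b i) = \sum_(k < r) e k * rres W'V (c k i)].

Definition coherent : Prop :=
  finite_type /\
  forall (U : opens T) (n : nat) (s : 'I_n -> M U), relations_finite_type s.

Definition injective_module : Prop :=
  forall (N N' : modSheaf A) (i : modHom N N') (f : modHom N M),
    (forall U, injective (i U)) ->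
    exists g : modHom N' M, forall U s, g U (i U s) = f U s.

End Coherent.

(* Cochain complexes; only the components d i (i + 1) are used. *)
Record complex (T : topologicalType) (A : ringSheaf T) := Complex {
  cterm :> int -> modSheaf A;
  cdiff : forall i j, modHom (cterm i) (cterm j);
  cdiff_sqr : forall i j k, j = i + 1 -> k = j + 1 ->
    forall U s, cdiff j k U (cdiff i j U s) = 0
}.

Section Dualizing.
Variables (T : topologicalType) (A : ringSheaf T) (K : complex A).
Local Notation d := (cdiff K).

(* H is the i-th cohomology sheaf of K: pi, defined on cocycles, is locally
   surjective and its kernel consists of the local coboundaries. *)
Definition is_cohomology (i : int) (H : modSheaf A) (pi : forall U, K i U -> H U) :=
  let cocycle U (s : K i U) := d i (i + 1) U s = 0 in
  [/\ forall U (a : A U) s t, cocycle U s -> cocycle U t ->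
        pi U (a *: s + t) = a *: pi U s + pi U t,
      forall (U V : opens T) (VU : V `<=` U) s, cocycle U s ->
        pi V (mres VU s) = mres VU (pi U s),
      forall (U : opens T) (h : H U) x, U x ->
        exists (V : opens T) (VU : V `<=` U) (s : K i V),
          [/\ V x, cocycle V s & pi V s = mres VU h] &
      forall (U : opens T) s, cocycle U s ->
        (pi U s = 0 <->
         forall x, U x -> exists (V : opens T) (VU : V `<=` U) (t : K (i - 1) V),
           V x /\ mres VU s = d (i - 1) i V t)].

Definition coherent_cohomology : Prop :=
  forall i, exists (H : modSheaf A) (pi : forall U, K i U -> H U),
    is_cohomology pi /\ coherent H.

(* f restricts to a homomorphism M|U -> N|U; its values on opens not contained
   in U are irrelevant. *)
Definition hom_on (U : opens T) (M N : modSheaf A) (f : forall V, M V -> N V) : Prop :=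
  forall V : opens T, V `<=` U ->
    (forall (a : A V) s t, f V (a *: s + t) = a *: f V s + f V t) /\
    (forall (W : opens T) (WV : W `<=` V) s, f W (mres WV s) = mres WV (f V s)).

(* Elements of degree n of the complex of sheaves Hom(K, K) over U: the
   components phi i j with j = i + n. *)
Definition hom_family := forall (i j : int) (V : opens T), K i V -> K j V.

Definition hom_deg (U : opens T) (n : int) (phi : hom_family) : Prop :=
  forall i j, j = i + n -> hom_on U (phi i j).

(* The differential d phi - (-1)^n phi d of phi of degree n; the component from
   K i to K j, where j = i + n + 1. *)
Definition hom_diff (n : int) (phi : hom_family) : hom_family :=
  fun i j V s => d (j - 1) j V (phi i (j - 1) V s)
    - (-1) ^+ `|n|%N *: phi (i + 1) j V (d i (i + 1) V s).

Arguments hom_diff n phi i j V s : clear implicits.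

Definition hom_cocycle (U : opens T) (n : int) (phi : hom_family) : Prop :=
  hom_deg U n phi /\
  forall i j, j = i + n + 1 ->
    forall V : opens T, V `<=` U -> forall s, hom_diff n phi i j V s = 0.

(* On U, multiplication by a is nullhomotopic, resp. phi is homotopic to
   multiplication by a. *)
Definition homotopic_to_scalar (U : opens T) (phi : hom_family) (a : A U) : Prop :=
  exists2 psi, hom_deg U (-1) psi &
    forall i (V : opens T) (VU : V `<=` U) s,
      phi i i V s = rres VU a *: s + hom_diff (-1) psi i i V s.

Definition hom_coboundary (U : opens T) (n : int) (phi : hom_family) : Prop :=
  exists2 psi, hom_deg U (n - 1) psi &
    forall i j, j = i + n ->
      forall V : opens T, V `<=` U -> forall s, phi i j V s = hom_diff (n - 1) psi i j V s.

(* A -> Hom(K, K) is a quasi-isomorphism of complexes of sheaves. *)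
Definition double_duality : Prop :=
  [/\ forall (U : opens T) (a : A U),
        homotopic_to_scalar (fun i j V s => 0) a -> a = 0,
      forall (U : opens T) phi, hom_cocycle U 0 phi ->
        forall x, U x -> exists (V : opens T) (a : A V),
          [/\ V x, V `<=` U & homotopic_to_scalar phi a] &
      forall (U : opens T) (n : int) phi, n <> 0 -> hom_cocycle U n phi ->
        forall x, U x -> exists V : opens T,
          [/\ V x, V `<=` U & hom_coboundary V n phi]].

(* A dualising complex represented by a bounded complex of injectives, for
   which RHom(K, K) is computed by Hom(K, K). *)
Definition dualizing : Prop :=
  [/\ exists a b : int, forall i, ~~ (a <= i <= b) -> forall U (s : K i U), s = 0,
      forall i, injective_module (K i),
      coherent_cohomology &
      double_duality].

End Dualizing.

Definition has_dualizing_complex (X : ringedSpace) : Prop :=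
  exists K : complex (rstruct X), dualizing K.

Section WittSheaf.
Variables (p : nat) (pp : prime p) (n : nat) (T : topologicalType).

Lemma witt_sheaf_axiom (A : ringSheaf T) :
  sheaf_axiom (F := fun U => witt pp n (A U)) (fun U V VU => witt_map (rres VU)).
Proof.
move=> U I V VU cov s sE.
have H (k : 'I_n) : exists! t : A U, forall i, rres (VU i) t = tnth (s i) k.
  apply: (@rres_sheaf _ A U I V VU cov (fun i => tnth (s i) k)) => i j W Wi Wj.
  by have := congr1 (fun t => tnth t k) (sE i j W Wi Wj); rewrite !tnth_map.
have [t tP] := choice H; exists [tuple t k | k < n]; split.
  move=> i; apply: eq_from_tnth => k.
  by rewrite !tnth_map tnth_ord_tuple; have [-> _] := tP k.
move=> t' t'P; apply: eq_from_tnth => k; rewrite tnth_map tnth_ord_tuple.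
have [_ u] := tP k; apply: u => i; rewrite -t'P.
by rewrite tnth_map.
Qed.

Program Definition witt_sheaf (A : ringSheaf T) : ringSheaf T :=
  {| rsec := fun U => witt pp n (A U); rres := fun U V VU => witt_map (rres VU) |}.
Next Obligation.
by move=> A U UU s; apply: eq_from_tnth => k; rewrite tnth_map rres_id.
Qed.
Next Obligation.
move=> A U V W VU WV WU s; apply: eq_from_tnth => k.
by rewrite !tnth_map (rres_comp VU WV WU).
Qed.
Next Obligation. exact: witt_sheaf_axiom. Qed.

Program Definition witt_rsmap (A B : ringSheaf T) (f : rsHom A B) :
  rsHom (witt_sheaf A) (witt_sheaf B) := {| rsmap := fun U => witt_map (f U) |}.
Next Obligation.
move=> A B f U V VU s; apply: eq_from_tnth => k.
by rewrite !tnth_map rsmap_res.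
Qed.

Program Definition witt_rsfst (n_gt0 : (0 < n)%N) (A : ringSheaf T) :
  rsHom (witt_sheaf A) A := {| rsmap := fun U => @witt_fst p pp n n_gt0 (A U) |}.
Next Obligation. by move=> n_gt0 A U V VU s; rewrite /= /witt_fst tnth_map. Qed.

End WittSheaf.

Definition witt_space (p : nat) (pp : prime p) (n : nat) (X : ringedSpace) :=
  {| rspace := rspace X; rstruct := witt_sheaf pp n (rstruct X) |}.

Section Frobenius.
Variables (p : nat) (pp : prime p) (R : comPzRingType) (p_eq0 : p%:R = 0 :> R).

(* pFrobenius_aut is only available for nontrivial rings. *)
Definition frob (x : R) : R := x ^+ p.

Lemma frob_zmod : zmod_morphism frob.
Proof.
have pk0 (c : R) : c *+ p ^ 1 = 0 by rewrite expn1 -mulr_natl p_eq0 mul0r.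
move=> x y; rewrite /frob.
have [c ->] := Witt.pdvdpD pp x (- y); have [c' ->] := Witt.pdvdpN pp y.
by rewrite !pk0 !addr0.
Qed.
Lemma frob_monoid : monoid_morphism frob.
Proof. by split=> [|x y]; rewrite /frob ?expr1n ?exprMn. Qed.

Definition frobm : {rmorphism R -> R} := HB.pack frob
  (GRing.isZmodMorphism.Build _ _ frob frob_zmod)
  (GRing.isMonoidMorphism.Build _ _ frob frob_monoid).
End Frobenius.

Section QuasiFrobeniusSplitting.
Variables (p : nat) (pp : prime p) (T : topologicalType) (A : ringSheaf T).
Hypothesis chA : char_p p A.

Program Definition frobenius : rsHom A A :=
  {| rsmap := fun U => frobm pp (chA U) |}.
Next Obligation. by move=> U V VU s; rewrite /= /frob rmorphXn. Qed.

(* The target of hom_via frobenius is A as a module via F, that is, F_* A. *)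
Definition F_split : Prop := splits (hom_via frobenius).

Variables (n : nat) (n_gt0 : (0 < n)%N) (e : nat).

(* F^e on W_n A; in characteristic p the Witt vector Frobenius is W_n(F). *)
Definition witt_frobenius : rsHom (witt_sheaf pp n A) (witt_sheaf pp n A) :=
  rs_iter (witt_rsmap pp n frobenius) e.

Definition mod_fst : modSheaf (witt_sheaf pp n A) := mod_via (witt_rsfst pp n_gt0 A).

(* (Q, Phi) is (Q^e_n, Phi^e_n). *)
Definition is_Q_Phi (Q : modSheaf (witt_sheaf pp n A)) (Phi : modHom mod_fst Q) : Prop :=
  exists j : modHom (mod_via witt_frobenius) Q,
    is_pushout (hom_via witt_frobenius) (hom_via (witt_rsfst pp n_gt0 A)) j Phi.

End QuasiFrobeniusSplitting.

(* Main.v *)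
Require Import Defs.
From HB Require Import structures.
From mathcomp Require Import all_boot all_order all_algebra all_field.
From mathcomp Require Import boolp classical_sets topology.

(** Composing with [j] and using the universal property, a splitting of [Phi]
  is the same as an additive map [theta : W_n O -> O] such that
  [theta 1 = 1] and [theta (F^e a * x) = a_0 * theta x].
  From a Frobenius splitting [r], the map [theta x := r^e (x_0)] is such a map.
  Conversely, let [theta] be given, with [e >= 2].  As [V y * V y = p V (y^2)],
  the map [a |-> [a]^p] is additive modulo [p W_n O], hence so is
  [a |-> [a]^(p^(e-1))]; since [theta] kills [p W_n O], the map
  [y |-> theta ([y]^(p^(e-1)))] is additive, and [F^e [a] = [a]^(p^e)] shows
  that it splits the Frobenius. *)

Set Implicit Arguments.
Unset Strict Implicit.
Unset Printing Implicit Defensive.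
Import GRing.Theory.
Local Open Scope ring_scope.

(** * Teichmüller lifts and Verschiebung on truncated Witt vectors *)

Section WittVectors.
Variables (p : nat) (pp : prime p) (n : nat).
Local Notation p0 := (prime_gt0 pp).

Definition teich (R : comPzRingType) (a : R) : witt pp n R :=
  [tuple if i == 0%N :> nat then a else 0 | i < n].

(** The Verschiebung as an endomap of [W_n]: entries shift up by one and the last entry of [x] is
    dropped. *)
Definition versch (R : comPzRingType) (x : witt pp n R) : witt pp n R :=
  [tuple (0 :: val x)`_i | i < n].

Lemma map_teich (R S : comPzRingType) (f : {rmorphism R -> S}) a :
  witt_map f (teich a) = teich (f a).
Proof.
by apply: eq_from_tnth => i; rewrite !tnth_map; case: ifP => // _; rewrite rmorph0.
Qed.

Lemma map_versch (R S : comPzRingType) (f : {rmorphism R -> S}) x :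
  witt_map f (versch x) = versch (witt_map f x).
Proof.
apply: eq_from_tnth => i; rewrite !tnth_map tnth_ord_tuple.
by case: (nat_of_ord i) => [|k] /=; rewrite ?rmorph0 // (Witt.nth_map0 f x).
Qed.

Lemma ghost_teich (R : comPzRingType) (a : R) k :
  (k < n)%N -> Witt.ghost p (teich a) k = a ^+ (p ^ k).
Proof.
move=> kn; have E i (h : (i < n)%N) : (teich a)`_i = if i == 0%N then a else 0.
  by rewrite -(tnth_nth _ (teich a) (Ordinal h)) tnth_map tnth_ord_tuple.
rewrite /Witt.ghost big_ord_recl /= E ?(leq_ltn_trans (leq0n k) kn) //= subn0 expn0.
rewrite mulr1n big1 ?addr0 // => i _.
rewrite E ?(leq_ltn_trans _ kn) //.
by rewrite expr0n expn_eq0 eqn0Ngt p0 /= mul0rn.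
Qed.

Lemma ghost_versch0 (R : comPzRingType) (x : witt pp n R) :
  (0 < n)%N -> Witt.ghost p (versch x) 0 = 0.
Proof.
move=> n0; rewrite /Witt.ghost big_ord1 expn0 expr1 mulr1n.
by rewrite -(tnth_nth _ (versch x) (Ordinal n0)) tnth_map tnth_ord_tuple.
Qed.

Lemma ghost_verschS (R : comPzRingType) (x : witt pp n R) k :
  (k.+1 < n)%N -> Witt.ghost p (versch x) k.+1 = Witt.ghost p x k *+ p.
Proof.
move=> kn; have E i (h : (i < n)%N) : (versch x)`_i = (0 :: val x)`_i.
  by rewrite -(tnth_nth _ (versch x) (Ordinal h)) tnth_map tnth_ord_tuple.
rewrite /Witt.ghost big_ord_recl /= E ?(leq_ltn_trans _ kn) //=.
rewrite expr0n expn_eq0 eqn0Ngt p0 /= mul0rn add0r -sumrMnl.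
apply: eq_bigr => i _; rewrite /bump /= add1n E ?(leq_ltn_trans _ kn) //=.
by rewrite subSS -mulrnA expnSr.
Qed.

(** Spells the multiple with the raw tuple operations, the form in which [Witt.generic] is applied
    in [versch_sqr]. *)
Lemma iter_addE (R : comPzRingType) (x : witt pp n R) m :
  iter m (Witt.add pp x) (Witt.zero n R) = x *+ m.
Proof. by elim: m => [|m ih]; rewrite ?mulr0n // mulrS -ih. Qed.

Lemma teichM (R : comPzRingType) (a b : R) : teich (a * b) = teich a * teich b.
Proof.
have [n0|n0] := posnP n.
  by apply: eq_from_tnth => i; have := ltn_ord i; rewrite {2}n0.
have H (c : R) : (teich c)`_0 = c.
  by rewrite -(tnth_nth _ (teich c) (Ordinal n0)) tnth_map tnth_ord_tuple.
have mapH (S S' : comPzRingType) (f : {rmorphism S -> S'}) (x : n.-tuple S) :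
    [tuple of map f x]`_0 = f x`_0 by exact: Witt.nth_map0.
(* [Witt.generic] ranges over Witt vectors, so the scalars [a] and [b] enter as the zeroth entries
   of their Teichmüller lifts; hence the separate case [n = 0] above. *)
have := @Witt.generic p pp n R (teich a) (teich b) (teich b)
  (fun S x y z => teich (x`_0 * y`_0))
  (fun S x y z => Witt.mul pp (teich x`_0) (teich y`_0)).
rewrite !H; apply => [S S' f x y z|S S' f x y z|x y z k kn].
- by rewrite !mapH -rmorphM; exact: map_teich.
- rewrite !mapH Witt.map_mul; congr Witt.mul; exact: map_teich.
- by rewrite Witt.ghost_mul // !ghost_teich // exprMn.
Qed.

Lemma teich1 (R : comPzRingType) : teich (1 : R) = 1.
Proof. by apply: eq_from_tnth => i; rewrite !tnth_map; case: ifP. Qed.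

Lemma teichX (R : comPzRingType) (a : R) m : teich (a ^+ m) = teich a ^+ m.
Proof. by elim: m => [|m ih]; rewrite ?expr0 ?teich1 // !exprS teichM ih. Qed.

(** Generically it suffices to compare ghost components: at 0 both sides vanish, and at [k.+1] both
    are [p^2 * w_k(y)^2], where [w_k] is the ghost component. *)
Lemma versch_sqr (R : comPzRingType) (y : witt pp n R) :
  versch y ^+ 2 = versch (y ^+ 2) *+ p.
Proof.
rewrite !expr2 -iter_addE.
have mapI (S S' : comPzRingType) (f : {rmorphism S -> S'}) (x : n.-tuple S) m :
    [tuple of map f (iter m (Witt.add pp x) (Witt.zero n S))] =
    iter m (Witt.add pp [tuple of map f x]) (Witt.zero n S').
  by elim: m => [|m ih]; rewrite /= ?Witt.map_zero // Witt.map_add ih.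
have := @Witt.generic p pp n R y y y
  (fun S x _ _ => Witt.mul pp (versch x) (versch x))
  (fun S x _ _ => iter p (Witt.add pp (versch (Witt.mul pp x x))) (Witt.zero n S)).
apply => [S S' f x _ _|S S' f x _ _|x _ _ k kn].
- by rewrite Witt.map_mul; congr Witt.mul; exact: map_versch.
- rewrite mapI; have -> : [tuple of map f (versch (Witt.mul pp x x))] =
    versch [tuple of map f (Witt.mul pp x x)] by exact: map_versch.
  by rewrite Witt.map_mul.
- have ghostI (z : witt pp n (Witt.free_sort (Witt.free pp (n + n + n)))) m :
    Witt.ghost p (iter m (Witt.add pp z) (Witt.zero n _)) k = Witt.ghost p z k *+ m.
    elim: m => [|m ih] /=; first exact: Witt.ghost_zero.
    by rewrite Witt.ghost_add // ih mulrS.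
  rewrite ghostI Witt.ghost_mul //; case: k kn {ghostI} => [|k] kn.
    by rewrite !ghost_versch0 // mulr0 mul0rn.
  by rewrite !ghost_verschS // Witt.ghost_mul 1?ltnW // mulrnAl mulrnAr.
Qed.

Lemma witt_versch (n_gt0 : (0 < n)%N) (R : comPzRingType) (x : witt pp n R) :
  witt_fst n_gt0 x = 0 -> exists y : witt pp n R, x = versch y.
Proof.
(* The last entry of this shift is the default value 0, which [versch] discards. *)
move=> x0; exists [tuple x`_i.+1 | i < n]; apply: eq_from_tnth => i.
rewrite tnth_map tnth_ord_tuple; case: i => [[|k] kn] /=.
  by rewrite -x0; congr tnth; apply: val_inj.
have kn' := ltnW kn.
rewrite -(tnth_nth _ [tuple x`_i.+1 | i < n] (Ordinal kn')) tnth_map tnth_ord_tuple.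
by rewrite (tnth_nth 0).
Qed.

Lemma witt_fst_teich (n_gt0 : (0 < n)%N) (R : comPzRingType) (a : R) :
  witt_fst n_gt0 (teich a) = a.
Proof. by rewrite /witt_fst tnth_map tnth_ord_tuple. Qed.

(** The additivity defect of [teich] is some [V y], whose [p]-th power is a multiple of [p]; further
    [p]-th powers preserve the congruence. At least one [p]-th power is taken, whence the exponent
    [m.+1]. *)
Lemma teich_pD (n_gt0 : (0 < n)%N) (R : comPzRingType) (a b : R) m :
  Witt.pdvd p 1 (teich (a + b) ^+ (p ^ m.+1))
    (teich a ^+ (p ^ m.+1) + teich b ^+ (p ^ m.+1)).
Proof.
elim: m => [|m ih]; last first.
  rewrite !(expnSr _ m.+1) !exprM.
  exact: Witt.pdvd_trans (Witt.pdvdX p ih) (Witt.pdvdpD pp _ _).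
have [y yP] : exists y, teich (a + b) - (teich a + teich b) = versch y.
  by apply: (witt_versch (n_gt0 := n_gt0)); rewrite rmorphB rmorphD /= !witt_fst_teich subrr.
rewrite expn1 -[teich (a + b)](subrK (teich a + teich b)) yP.
apply: Witt.pdvd_trans (Witt.pdvdpD pp _ _) _.
rewrite -[X in Witt.pdvd p 1 _ X]add0r; apply: Witt.pdvdD; last exact: Witt.pdvdpD.
(* As [p >= 2], a factor [(V y)^2 = p V(y^2)] splits off. *)
have -> : versch y ^+ p = versch y ^+ (p - 2) * versch y ^+ 2.
  by rewrite -exprD subnK ?prime_gt1.
by rewrite versch_sqr mulrnAr; eexists; rewrite add0r expn1.
Qed.

Lemma witt_fst_map (n_gt0 : (0 < n)%N) (R S : comPzRingType)
    (f : {rmorphism R -> S}) (x : witt pp n R) :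
  witt_fst n_gt0 (witt_map f x) = f (witt_fst n_gt0 x).
Proof. exact: tnth_map. Qed.

End WittVectors.

(** * The iterated Witt vector Frobenius on sections *)

Section Splittings.
Variables (p : nat) (pp : prime p) (T : topologicalType) (A : ringSheaf T).
Hypothesis chA : char_p p A.
Variables (n : nat) (n_gt0 : (0 < n)%N) (e : nat).
Local Notation WF := (@witt_frobenius p pp T A chA n e).
Local Notation wfst := (@witt_fst p pp n n_gt0 _).
Local Notation M := (mod_via WF).
Local Notation L := (mod_fst pp A n_gt0).

Lemma witt_frobenius_teich (U : opens T) (a : A U) :
  WF U (teich pp n a) = teich pp n a ^+ (p ^ e).
Proof.
rewrite /witt_frobenius; elim: e => [|m ih] /=; first by rewrite expn0 expr1.
rewrite ih -teichX (map_teich pp n (frobm pp (chA U))) /= /frob.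
by rewrite -exprM -expnSr teichX.
Qed.

Lemma witt_fst_frobenius (U : opens T) (x : witt pp n (A U)) :
  wfst (WF U x) = wfst x ^+ (p ^ e).
Proof.
rewrite /witt_frobenius; elim: e => [|m ih] /=; first by rewrite expn0 expr1.
by rewrite (witt_fst_map n_gt0 (frobm pp (chA U))) ih /= /frob -exprM -expnSr.
Qed.

(** * From a Frobenius splitting [r] to the map theta *)

Section FromFsplit.
Variable r : modHom (mod_via (frobenius pp chA)) (mod_self A).

Definition iter_trace (U : opens T) (x : M U) : L U :=
  iter e (r U : A U -> A U) (wfst x).

Lemma traceD (U : opens T) (x y : A U) : (r U : A U -> A U) (x + y) =
  (r U : A U -> A U) x + (r U : A U -> A U) y.
Proof. exact: raddfD. Qed.
Lemma traceZ (U : opens T) (a x : A U) : (r U : A U -> A U) (a ^+ p * x) =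
  a * (r U : A U -> A U) x.
Proof. exact: (linearZ_LR (r U) a x). Qed.

(** On first components [F^e] is the [p^e]-th power, and each of the [e] applications of [r] takes
    one [p]-th power out of the scalar. *)
Lemma iter_trace_linear U : linear (@iter_trace U).
Proof.
(* Both module structures unfolded: [a] acts on the source through [F^e], on the target through its
   first component. *)
move=> a x y; change (iter e (r U : A U -> A U)
    (wfst (WF U a * (x : witt pp n (A U)) + y)) =
  wfst a * iter_trace x + iter_trace y).
rewrite rmorphD rmorphM /= witt_fst_frobenius /iter_trace.
move: (witt_fst _ a) (witt_fst _ x) (witt_fst _ y) => {}a {}x {}y.
elim: e x y => [|m ih] x y; first by rewrite expn0 expr1.
by rewrite !iterSr expnSr exprM traceD traceZ ih.
Qed.
HB.instance Definition _ U := GRing.isLinear.Build _ _ _ _ (@iter_trace U)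
  (@iter_trace_linear U).

Lemma iter_trace_res (U V : opens T) (VU : (V `<=` U)%classic) (x : M U) :
  mres VU (iter_trace x) = iter_trace (mres VU x).
Proof.
change (rres VU (iter e (r U : A U -> A U) (wfst x)) =
  iter e (r V : A V -> A V) (wfst (witt_map (rres VU) x))).
rewrite witt_fst_map.
elim: e (witt_fst _ _) => [|m ih] y //; rewrite !iterSr ih.
by congr (iter _ _ _); exact: (mhom_res r VU y).
Qed.

Definition iter_trace_hom : modHom M L :=
  {| mhom := fun U => @iter_trace U; mhom_res := @iter_trace_res |}.

(** The compatibility that lets theta and the identity of [O] factor together through the
    pushout. *)
Lemma iter_trace_frobenius (U : opens T) (a : witt pp n (A U)) :
  (forall U s, r U (hom_via (frobenius pp chA) U s) = s) ->
  iter_trace (WF U a) = wfst a.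
Proof.
move=> rF; have rX (x : A U) : (r U : A U -> A U) (x ^+ p) = x by exact: rF.
rewrite /iter_trace witt_fst_frobenius.
elim: e => [|m ih]; first by rewrite expn0 expr1.
by rewrite iterSr expnSr exprM rX.
Qed.

End FromFsplit.

(** * From theta to a Frobenius splitting *)

Section ToFsplit.
Variable theta : modHom M L.
Hypothesis theta1 : forall U, theta U (1 : witt pp n (A U)) = (1 : A U).
Hypothesis e_ge2 : (2 <= e)%N.

(** The exponent has [e.-1] because a scalar [a] already acts on the source by [a^p], and
    [[a^p]^(p^(e-1)) = F^e [a]]. *)
Definition teich_trace (U : opens T) (y : mod_via (frobenius pp chA) U) :
    mod_self A U :=
  theta U (teich pp n y ^+ (p ^ e.-1)).

(** Theta is additive with values in [O], where [p = 0]. *)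
Lemma theta_pdvd (U : opens T) (x y : witt pp n (A U)) :
  Witt.pdvd p 1 x y -> theta U x = theta U y.
Proof.
move=> [c ->]; rewrite expn1.
transitivity (theta U y + theta U c *+ p); first by rewrite -raddfMn -raddfD.
suff -> : theta U c *+ p = 0 by rewrite addr0.
have : (theta U c : A U) *+ p = 0 by rewrite -mulr_natl chA mul0r.
exact.
Qed.

Lemma thetaZ (U : opens T) (a x : witt pp n (A U)) :
  (theta U : _ -> A U) (WF U a * x) = wfst a * (theta U : _ -> A U) x.
Proof. exact: (linearZ_LR (theta U) a x). Qed.

Lemma teich_traceM (U : opens T) (a y : A U) :
  (teich_trace (U := U) : A U -> A U) (a ^+ p * y) =
  a * (teich_trace (U := U) : A U -> A U) y.
Proof.
rewrite /teich_trace teichM teichX exprMn -exprM -expnS prednK ?(ltnW e_ge2) //.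
rewrite -witt_frobenius_teich; have := thetaZ (teich pp n a).
by rewrite witt_fst_teich; apply.
Qed.

Lemma teich_trace_linear U : linear (@teich_trace U).
Proof.
move=> a x y; change (theta U (teich pp n (a ^+ p * (x : A U) + (y : A U)) ^+ (p ^ e.-1)) =
  a * (teich_trace x : A U) + (teich_trace y : A U)).
rewrite -teich_traceM; move: (a ^+ p * (x : A U)) => {a}x.
have := theta_pdvd (teich_pD pp n_gt0 (x : A U) (y : A U) e.-2).
(* This is where [e >= 2] is essential: [teich_pD] needs an exponent [p^(e-1)] with [e-1]
   positive. *)
have -> : e.-2.+1 = e.-1 by case: (e) e_ge2 => [|[]].
by move=> E; apply: etrans E _; exact: raddfD.
Qed.
HB.instance Definition _ U := GRing.isLinear.Build _ _ _ _ (@teich_trace U)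
  (@teich_trace_linear U).

Lemma teich_trace_res (U V : opens T) (VU : (V `<=` U)%classic)
    (y : mod_via (frobenius pp chA) U) :
  mres VU (teich_trace y) = teich_trace (mres VU y).
Proof.
transitivity (theta V (mres VU (teich pp n (y : A U) ^+ (p ^ e.-1) : M U))).
  exact: (mhom_res theta VU).
congr (theta V _).
rewrite -[LHS]/(witt_map (rres VU) (teich pp n (y : A U) ^+ (p ^ e.-1))).
by rewrite rmorphXn /= map_teich.
Qed.

Definition teich_trace_hom : modHom (mod_via (frobenius pp chA)) (mod_self A) :=
  {| mhom := fun U => @teich_trace U; mhom_res := @teich_trace_res |}.

Lemma F_split_of_theta : F_split pp chA.
Proof.
exists teich_trace_hom => U s.
(* Taking [y = 1] gives [teich_trace (s^p) = s * theta 1 = s]. *)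
have := teich_traceM (s : A U) 1; rewrite mulr1 => E.
rewrite -[LHS]/(teich_trace (U := U) ((s : A U) ^+ p)) E /teich_trace teich1 expr1n.
by rewrite theta1 mulr1.
Qed.

End ToFsplit.
End Splittings.

(** * Composition of module homomorphisms, and the equivalence via the pushout *)

Definition mod_id (T : topologicalType) (A : ringSheaf T) (M : modSheaf A) : modHom M M :=
  {| mhom := fun U => idfun; mhom_res := fun U V VU s => erefl |}.

Definition mod_comp (T : topologicalType) (A : ringSheaf T) (M N L : modSheaf A)
  (g : modHom N L) (f : modHom M N) : modHom M L.
Proof.
exists (fun U => g U \o f U) => U V VU s.
by rewrite /= !mhom_res.
Defined.

Theorem proposition3p8 (p : nat) (pp : prime p) (X : ringedSpace)
    (X_scheme : scheme X) (X_char : char_p p (rstruct X))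
    (X_dim : finite_dimensional (rspace X)) (X_integral : integral_scheme X)
    (X_normal : normal_scheme X) (X_noetherian : noetherian_scheme X)
    (X_F_finite : F_finite p X)
    (X_witt : forall m : nat, (0 < m)%N ->
       excellent_scheme (witt_space pp m X) /\
       has_dualizing_complex (witt_space pp m X))
    (e n : nat) (e_ge2 : (2 <= e)%N) (n_gt0 : (0 < n)%N)
    (Q : modSheaf (witt_sheaf pp n (rstruct X)))
    (Phi : modHom (mod_fst pp (rstruct X) n_gt0) Q)
    (Q_Phi : is_Q_Phi X_char e Phi) :
  F_split pp X_char <-> splits Phi.
Proof.
have [j [comm univ]] := Q_Phi; split.
- move=> [r rF].
  (* The pair of theta on [F^e_* W_n O] and the identity on [O] induces [w] on [Q]; its second
     compatibility says that [w] retracts [Phi]. *)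
  have [|w [_ wPhi _]] := univ _ (iter_trace_hom n_gt0 e r) (mod_id _).
    by move=> U s; exact: iter_trace_frobenius.
  by exists w.
(* Theta is [q] after [j]; since [F^e 1 = 1], the pushout square turns [q (j 1)] into
   [q (Phi 1) = 1]. *)
- move=> [q qPhi]; apply: (F_split_of_theta (theta := mod_comp q j)) => // U.
  have := comm U 1.
  have -> : hom_via (witt_frobenius pp X_char n e) U 1 = (1 : witt pp n _).
    exact: rmorph1.
  move=> /= ->; rewrite qPhi; exact: (rmorph1 (@witt_fst p pp n n_gt0 _)).
Qed.
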